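(* Let $A\in\mathbb{R}_+^{m\times n}$, $b\in\mathbb{R}_+^m$, and let $$\mathcal{F}_{A,b}=\{x\in\mathbb{R}^n:\ x_i^2-x_i=0\ \ \forall i\in\{1,\dots,n\},\ Ax\le b\}$$ be the feasible region of the corresponding $0/1$ packing problem. Let $\pi$ be a fixed positive integer. Then the $(\pi+1)$-SoS relaxation of $\mathcal{F}_{A,b}$ satisfies all valid inequalities for $\mathcal{F}_{A,b}$ of pitch at most $\pi$. That is, for every inequality $a_0-a^\top x\ge0$ with $a_0\ge0$, $a\ge0$ that holds for all $x\in\mathcal{F}_{A,b}$ and has (packing) pitch at most $\pi$, every feasible solution $y$ of the $(\pi+1)$-SoS relaxation satisfies $a_0-\sum_{i=1}^n a_i\,y[x_i]\ge0$.
   Context: **Packing pitch.** For a packing inequality $a_0-a^\top x\ge0$ with $a_0,a\ge0$ and indices ordered so that $0<a_1\le\dots\le a_h$ and $a_j=0$ for $j>h$, its pitch is the maximum integer $p\in\{0,1,\dots,n\}$ such that $a_0-\sum_{i=1}^{p}a_i\ge0$. **$d$-SoS relaxation.** For $p\in\mathbb{R}[x_1,\dots,x_n]$, $\overline{p}$ is its multilinear form (replace each $x_i^k$, $k\ge2$, by $x_i$). Let $\mathcal{S}$ be the set of all multilinear monomials of degree at most $d$, with span $\langle\mathcal{S}\rangle$; put $x_0:=1$ and $T:=\{\overline{x_i p q}:p,q\in\mathcal{S},\ 0\le i\le n\}$. The feasible solutions of the $d$-SoS relaxation of a set $\{x\in\mathbb{R}^n:x_i^2-x_i=0\ \forall i,\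 g_j(x)\ge0\ \forall j\}$ with linear $g_j$ are the linear functionals $y:\langle T\rangle\to\mathbb{R}$ such that $y[1]=1$, $y[\overline{q^2}]\ge0$ and $y[\overline{q^2g_j}]\ge0$ for all $q\in\langle\mathcal{S}\rangle$ and all $j$. For $\mathcal{F}_{A,b}$ the constraints $g_j\ge0$ are the rows of $b-Ax\ge0$ together with $x_i\ge0$ for $i\in\{1,\dots,n\}$. *)

(* Defs.v *)
From mathcomp Require Import all_boot all_order all_algebra.
From mathcomp Require Import reals mpoly.
Set Implicit Arguments.
Unset Strict Implicit.
Unset Printing Implicit Defensive.

Import Order.TTheory GRing.Theory Num.Theory.
Local Open Scope ring_scope.

Section SoS.
Variables (R : realType) (n : nat).
Implicit Types (P : {mpoly R[n]} -> Prop) (p q : {mpoly R[n]}).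
Implicit Types (y : {mpoly R[n]} -> R) (d : nat).

Definition multilin_mon (m : 'X_{1..n}) : 'X_{1..n} :=
  [multinom minn (m i) 1 | i < n].

Definition multilin p : {mpoly R[n]} :=
  \sum_(m <- msupp p) p@_m *: 'X_[multilin_mon m].

Definition in_span P p : Prop :=
  exists (k : nat) (c : 'I_k -> R) (t : 'I_k -> {mpoly R[n]}),
    (forall i, P (t i)) /\ p = \sum_(i < k) c i *: t i.

Definition sos_S d p : Prop :=
  exists m : 'X_{1..n},
    [/\ forall i, (m i <= 1)%N, (mdeg m <= d)%N & p = 'X_[m]].

(** [x_0 = 1], and index [lift ord0 i] of ['I_n.+1] stands for the variable
    ['X_i]. *)
Definition hvar (k : 'I_n.+1) : {mpoly R[n]} :=
  if unlift ord0 k is Some i then 'X_i else 1.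

Definition sos_T d p : Prop :=
  exists (k : 'I_n.+1) (q r : {mpoly R[n]}),
    [/\ sos_S d q, sos_S d r & p = multilin (hvar k * q * r)].

Definition linear_on P y : Prop :=
  forall (c : R) p q, P p -> P q -> y (c *: p + q) = c * y p + y q.

(** A functional on the span of [sos_T d] is encoded as a total function on
    polynomials that is linear on that span; its values elsewhere are
    unconstrained.  When the [g j] have degree at most 1, as is assumed of
    the relaxation, every polynomial to which [y] is applied below lies in the
    span. *)
Definition sos_feasible d (J : Type) (g : J -> {mpoly R[n]}) y : Prop :=
  [/\ linear_on (in_span (sos_T d)) y,
      y 1 = 1,
      forall q, in_span (sos_S d) q -> 0 <= y (multilin (q ^+ 2)) &
      forall q (j : J), in_span (sos_S d) q ->
        0 <= y (multilin (q ^+ 2 * g j))].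

End SoS.

Section Packing.
Variables (R : realType) (m n : nat).

Definition packing_feasible (A : 'M[R]_(m, n)) (b : 'cV[R]_m)
    (x : 'cV[R]_n) : Prop :=
  (forall i, x i 0 ^+ 2 - x i 0 = 0) /\
  (forall j, (A *m x) j 0 <= b j 0).

Definition packing_constraint (A : 'M[R]_(m, n)) (b : 'cV[R]_m)
    (k : 'I_m + 'I_n) : {mpoly R[n]} :=
  match k with
  | inl j => (b j 0)%:MP - \sum_(i < n) A j i *: 'X_i
  | inr i => 'X_i
  end.

(** The coefficients of [a] rearranged as [0 < a_1 <= ... <= a_h] followed by
    the zero coefficients; meant for [a] with nonnegative entries. *)
Definition pitch_order (a : 'cV[R]_n) : seq R :=
  let s := [seq a i 0 | i <- enum 'I_n] in
  sort <=%R [seq c <- s | 0 < c] ++ [seq c <- s | c == 0].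

(** For [0 <= a0] the maximum is over a nonempty set, as [p = 0] qualifies. *)
Definition packing_pitch (a0 : R) (a : 'cV[R]_n) : nat :=
  (\max_(p < n.+1 | (0 <= a0 - \sum_(i < p) (pitch_order a)`_i)%R) p)%N.

End Packing.

(* Main.v *)
Require Import Defs.
From mathcomp Require Import all_boot all_order all_algebra.
From mathcomp Require Import reals ssrcomplements mpoly.
From mathcomp Require Import ring zify.
Set Implicit Arguments.
Unset Strict Implicit.
Unset Printing Implicit Defensive.

Import Order.TTheory GRing.Theory Num.Theory.
Local Open Scope ring_scope.

(** Let [z J] be the value of [y] at the squarefree monomial of a set [J] of
    variables, put [d = pi + 1], let [S] be the support of [a], and call
    [J \subset S] good when its indicator vector satisfies the packing
    constraints.  Being good passes to subsets since [A >= 0], and a good set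
    satisfies the valid inequality, so that it has at most [pi] elements by the
    hypothesis on the pitch.

    If [J] is infeasible and has at most [d] elements, then [z J = 0]
    ([infeasible_set_moment_eq0]): multiplying a row violated by [J] by the
    square of the monomial of [J] leaves a negative multiple of [z J] minus
    nonnegative terms, while [z J] itself is nonnegative.  This extends to
    unions [L] of two good sets that are not good.  Such an [L] may have up to
    [2 * pi] elements, but if it has more than [d] then any [I \subset L] with [d] elements is not good, so [z I = 0], and
    the Cauchy-Schwarz inequality for the positive semidefinite form of [y]
    carries this to [L = I :|: (L :\: I)] ([psd_moment_eq0]).

    Hence [z], truncated to [0] outside the good sets, behaves as the
    moment function of a full, untruncated positive semidefinite functional.
    Such functions are exactly the moment functions of nonnegative measures
    on subsets: the weight of [I] is the value of the quadratic form at the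
    Moebius function of [I] ([positive_moments_measure]).  The
    resulting measure has total mass [1] and lives on the good sets, where the
    valid inequality holds pointwise; integrating the inequality gives the
    claim. *)

(** * Moebius inversion on subsets *)

(** When [I] is a proper subset of [S], toggling a fixed element of [S :\: I]
    cancels the terms in pairs. *)
Lemma sum_sign_interval (R : comNzRingType) (T : finType) (I S : {set T}) :
  \sum_(K : {set T} | (I \subset K) && (K \subset S)) (-1) ^+ #|K|
    = (-1) ^+ #|I| *+ (I == S) :> R.
Proof.
have [<-|neIS] := eqVneq I S.
  rewrite (big_pred1 I) // => K; rewrite /= andbC -eqEsubset //.
rewrite mulr0n.
have [sIS|/negP nsIS] := boolP (I \subset S); last first.
  rewrite big1 // => K /andP[IK KS]; case: nsIS; exact: subset_trans IK KS.
have /properP[_ [e eS eI]] : I \proper S by rewrite properEneq neIS.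
rewrite (bigID (fun K : {set T} => e \in K)) /=.
rewrite (reindex_onto (fun K => e |: K) (fun K => K :\ e)) /=; last first.
  by move=> K /andP[_ eK]; rewrite setD1K.
rewrite (eq_bigl (fun K : {set T} =>
  (I \subset K) && (K \subset S) && (e \notin K))); last first.
  move=> K; rewrite setU11 andbT.
  have -> : ((e |: K) :\ e == K) = (e \notin K).
    apply/eqP/idP => [<-|eK]; first by rewrite !inE eqxx.
    by rewrite setU1K.
  case: (boolP (e \in K)) => eK; rewrite ?andbF ?andbT //.
  rewrite subUset sub1set eS /=; congr (_ && _).
  by rewrite -{2}(setU1K eK) subsetD1 eI andbT.
rewrite -big_split /= big1 // => K /andP[_ eK].
by rewrite cardsU1 eK add1n exprS mulN1r addNr.
Qed.

(** The sign is written with both cardinals, in place of the cardinal of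
    [J :\: I], so that it factors into a part in [I] and a part in [J]. *)
Definition moebius (R : comNzRingType) (T : finType) (I J : {set T}) : R :=
  ((-1) ^+ #|I| * (-1) ^+ #|J|) *+ (I \subset J).

Lemma moebius_zeta (R : comNzRingType) (T : finType) (I S : {set T}) :
  \sum_(J : {set T} | J \subset S) moebius R I J = (I == S)%:R.
Proof.
rewrite /moebius; under eq_bigr do rewrite mulrb.
rewrite -big_mkcondr /= -mulr_sumr.
under eq_bigl do rewrite andbC.
by rewrite sum_sign_interval mulrnAr -expr2 sqrr_sign.
Qed.

Lemma zeta_moebius (R : comNzRingType) (T : finType) (I S : {set T}) :
  \sum_(J : {set T} | I \subset J) moebius R J S = (I == S)%:R.
Proof.
rewrite /moebius; under eq_bigr do rewrite mulrb.
rewrite -big_mkcondr /= -mulr_suml sum_sign_interval mulrnAl.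
by have [->|] := eqVneq I S; rewrite ?mulr0n // -expr2 sqrr_sign.
Qed.

(** * Positive semidefinite moment functions on subsets *)

(** The measure is [mu I = \sum_J moebius R I J * z J] over good [J].  Its
    nonnegativity holds because the polynomial with coefficients
    [moebius R I] takes the value [1] at [I] and [0] at every other set, hence
    equals its own square; and the truncation of that polynomial to good
    monomials, which has degree at most [d], gives the same quadratic form,
    since [z] vanishes on unions of good sets that are not good. *)
Lemma positive_moments_measure (R : realDomainType) (T : finType) (d : nat)
    (z : {set T} -> R) (good : pred {set T}) :
  (forall c : {set T} -> R,
     0 <= \sum_(J : {set T} | (#|J| <= d)%N) \sum_(K : {set T} | (#|K| <= d)%N)
            c J * c K * z (J :|: K)) ->
  (forall J, good J -> (#|J| <= d)%N) ->
  (forall J K : {set T}, K \subset J -> good J -> good K) ->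
  (forall J K, good J -> good K -> ~~ good (J :|: K) -> z (J :|: K) = 0) ->
  exists mu : {set T} -> R,
    [/\ forall I, 0 <= mu I,
        forall I, ~~ good I -> mu I = 0 &
        forall J, (if good J then z J else 0)
          = \sum_(I : {set T} | J \subset I) mu I].
Proof.
move=> psd good_d good_sub z_bad.
pose z' J := if good J then z J else 0.
pose mu I := \sum_J moebius R I J * z' J.
have z'_mu J : z' J = \sum_(I : {set T} | J \subset I) mu I.
  rewrite exchange_big /=; under eq_bigr do rewrite -mulr_suml zeta_moebius.
  rewrite (bigD1 J) //= eqxx mul1r big1 ?addr0 // => K /negPf.
  by rewrite eq_sym => ->; rewrite mul0r.
exists mu; split=> // [I|I badI]; last first.
  rewrite /mu big1 // => J _; rewrite /moebius.
  case: (boolP (I \subset J)) => IJ; last by rewrite mulr0n mul0r.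
  rewrite /z' ifN ?mulr0 //; apply: contra badI; exact: good_sub.
(* Both sides integrate against [mu] the square of the indicator of [I]. *)
have -> : mu I = \sum_J \sum_K moebius R I J * moebius R I K * z' (J :|: K).
  transitivity (\sum_(L : {set T}) \sum_(J : {set T} | J \subset L)
      \sum_(K : {set T} | K \subset L) moebius R I J * moebius R I K * mu L).
    rewrite (bigD1 I) //= [X in _ + X]big1 ?addr0 => [|L neLI].
      under eq_bigr do rewrite -mulr_suml -mulr_sumr moebius_zeta eqxx mulr1.
      by rewrite -mulr_suml moebius_zeta eqxx mul1r.
    rewrite big1 // => J _; rewrite -mulr_suml -mulr_sumr moebius_zeta.
    by rewrite eq_sym (negPf neLI) mulr0 mul0r.
  rewrite (exchange_big_dep predT) //=; apply: eq_bigr => J _.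
  rewrite (exchange_big_dep predT) //=; apply: eq_bigr => K _.
  rewrite z'_mu mulr_sumr; apply: eq_bigl => L.
  by rewrite subUset.
(* Restricting the coefficients to good sets makes [psd] applicable. *)
pose c J := if good J then moebius R I J else 0.
suff -> : \sum_J \sum_K moebius R I J * moebius R I K * z' (J :|: K) =
    \sum_(J : {set T} | (#|J| <= d)%N) \sum_(K : {set T} | (#|K| <= d)%N)
       c J * c K * z (J :|: K) by exact: psd.
rewrite [RHS]big_mkcond; apply: eq_bigr => J _.
have good_U K L : good (K :|: L) -> good K && good L.
  by move=> gKL; rewrite !(good_sub _ _ _ gKL) ?subsetUl ?subsetUr.
case: ifP => [Jd|/negP nJd]; last first.
  apply: big1 => K _; rewrite /z' ifN ?mulr0 //.
  by apply/negP => /good_U/andP[/good_d].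
rewrite [RHS]big_mkcond; apply: eq_bigr => K _.
case: ifP => [Kd|/negP nKd]; last first.
  rewrite /z' ifN ?mulr0 //.
  by apply/negP => /good_U/andP[_ /good_d].
rewrite /c /z'; case: ifP => [/good_U/andP[-> ->] //|/negbT badJK].
case: ifP => gJ; last by rewrite !mul0r mulr0.
by case: ifP => gK; [rewrite z_bad ?badJK // | ]; rewrite !(mulr0, mul0r).
Qed.

(** The form at [t] times the monomial of [I] plus that of [K] is affine in [t]
    with slope [2 * z (I :|: K)], as the
    coefficient [z I] of [t ^+ 2] vanishes; being nonnegative for all [t], it is
    constant. *)
Lemma psd_moment_eq0 (R : realFieldType) (T : finType) (d : nat)
    (z : {set T} -> R) :
  (forall c : {set T} -> R,
     0 <= \sum_(J : {set T} | (#|J| <= d)%N) \sum_(K : {set T} | (#|K| <= d)%N)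
            c J * c K * z (J :|: K)) ->
  forall I K : {set T}, (#|I| <= d)%N -> (#|K| <= d)%N ->
  z I = 0 -> z (I :|: K) = 0.
Proof.
move=> psd I K Id Kd zI0.
have [<-|neIK] := eqVneq I K; first by rewrite setUid.
have quad t : 0 <= 2 * t * z (I :|: K) + z K.
  pose c J : R := if J == I then t else (J == K)%:R.
  have sum_c (F : {set T} -> R) :
      \sum_(J : {set T} | (#|J| <= d)%N) c J * F J = t * F I + F K.
    rewrite (bigD1 I) //= (bigD1 K) /=; last by rewrite Kd eq_sym.
    rewrite /c eqxx [K == I]eq_sym (negPf neIK) eqxx mul1r big1 ?addr0 //.
    by move=> J /andP[/andP[_ /negPf ->] /negPf ->]; rewrite mul0r.
  have := psd c.
  under eq_bigr do under eq_bigr do rewrite -mulrA.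
  under eq_bigr do rewrite -mulr_sumr sum_c.
  rewrite sum_c !setUid zI0 [K :|: I]setUC; congr (0 <= _); ring.
apply/eqP; apply: contraT => nz.
(* At this [t] the affine function equals [-1]. *)
have := quad (- (z K + 1) / (2 * z (I :|: K))).
have -> : 2 * (- (z K + 1) / (2 * z (I :|: K))) * z (I :|: K) + z K = -1.
  by field.
by rewrite ler0N1.
Qed.

(** * Pitch *)

(** Whether or not the head of [s] is used by [t], it is at most the head of
    [t], and the tail of [t] is a subsequence of the tail of [s]. *)
Lemma sorted_sum_take_le (R : numDomainType) (s t : seq R) :
  sorted <=%R s -> subseq t s -> \sum_(i < size t) s`_i <= \sum_(x <- t) x.
Proof.
elim: s t => [|x s IHs] [|y t] //= s_sorted; rewrite ?big_ord0 ?big_nil //.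
move=> ts; rewrite big_ord_recl big_cons /=.
have {}s_sorted' := path_sorted s_sorted.
have sub_t : subseq t s.
  by move: ts; case: eqP => // _; apply: subseq_trans; exact: subseq_cons.
apply: lerD; last exact: IHs.
move: ts; case: eqP => [->//|_ /mem_subseq/(_ y)].
rewrite mem_head => /(_ isT) ys.
by move: s_sorted; rewrite (path_sortedE le_trans) => /andP[/allP/(_ _ ys)].
Qed.

(** The [#|J|] smallest positive coefficients sum to at most the coefficients
    on [J], hence to at most [a0]. *)
Lemma card_le_packing_pitch (R : realType) n (a0 : R) (a : 'cV[R]_n)
    (J : {set 'I_n}) :
  (forall i, i \in J -> 0 < a i 0) -> \sum_(i in J) a i 0 <= a0 ->
  (#|J| <= packing_pitch a0 a)%N.
Proof.
move=> aJ sum_le.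
have Jn : (#|J| < n.+1)%N by rewrite ltnS -[n in (_ <= n)%N]card_ord max_card.
apply: (@leq_bigmax_cond _ _ (fun p : 'I_n.+1 => p : nat) (Ordinal Jn)).
rewrite /= subr_ge0; apply: le_trans sum_le.
rewrite /pitch_order; set s := [seq a i 0 | i <- enum 'I_n].
set pos := [seq c <- s | 0 < c].
pose t := [seq a i 0 | i <- enum J].
have sub_t : subseq t pos.
  rewrite /pos /s filter_map; apply: map_subseq.
  have -> : enum J = [seq i <- [seq i <- enum 'I_n | 0 < a i 0] | i \in J].
    rewrite -filter_predI [enum J]/enum_mem -enumT; apply: eq_filter => i /=.
    by rewrite andb_idr //; exact: aJ.
  exact: filter_subseq.
have /(_ _ _ sub_t) sub_sort := subseq_sort (@le_total _ R) (@le_trans _ R).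
have -> : \sum_(i in J) a i 0 = \sum_(x <- sort <=%R t) x.
  by rewrite (perm_big t) ?perm_sort //= big_map big_enum.
have size_t : size (sort <=%R t) = #|J| by rewrite size_sort size_map -cardE.
apply: le_trans (sorted_sum_take_le _ sub_sort); last first.
  exact: sort_sorted le_total _.
rewrite size_t le_eqVlt; apply/orP; left; apply/eqP/eq_bigr => i _.
by rewrite nth_cat (leq_trans (ltn_ord i)) // -size_t; exact: size_subseq.
Qed.

(** * Multilinear forms and spans *)

(** Summing over a fixed index type, in place of the support of [p], is what
    makes linearity visible. *)
Lemma multilinE (R : realType) (n k : nat) (p : {mpoly R[n]}) :
  (msize p <= k)%N ->
  multilin p = \sum_(m : 'X_{1..n < k}) p@_m *: 'X_[multilin_mon m].
Proof.
move=> le_pk; pose I : subFinType _ := 'X_{1..n < k}.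
rewrite /multilin (big_mksub I) //=; first last.
- by move=> x /msize_mdeg_lt /leq_trans; apply.
- exact: msupp_uniq.
by rewrite big_rmcond //= => i; move/memN_msupp_eq0 ->; rewrite scale0r.
Qed.

Lemma multilin_linear (R : realType) (n : nat) c (p q : {mpoly R[n]}) :
  multilin (c *: p + q) = c *: multilin p + multilin q.
Proof.
pose k := maxn (msize (c *: p + q)) (maxn (msize p) (msize q)).
rewrite !(@multilinE _ _ k) ?leq_max ?leqnn ?orbT // scaler_sumr -big_split /=.
by apply: eq_bigr => m _; rewrite mcoeffD mcoeffZ scalerDl scalerA.
Qed.

Lemma multilin_sumX (R : realType) (n : nat) (I : Type) (r : seq I)
    (P : pred I) (c : I -> R) (e : I -> 'X_{1..n}) :
  multilin (\sum_(i <- r | P i) c i *: 'X_[e i])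
    = \sum_(i <- r | P i) c i *: 'X_[multilin_mon (e i)].
Proof.
elim: r => [|i r IHr]; first by rewrite !big_nil /multilin msupp0 big_nil.
rewrite !big_cons; case: (P i) => //.
rewrite multilin_linear IHr; congr (_ *: _ + _).
by rewrite /multilin msuppX big_seq1 mcoeffX eqxx scale1r.
Qed.

Lemma in_span_lin (R : realType) (n : nat) (P : {mpoly R[n]} -> Prop) c t p :
  P t -> in_span P p -> in_span P (c *: t + p).
Proof.
move=> Pt [k [c' [t' [Pt' ->]]]].
exists k.+1, (fun i => oapp c' c (unlift ord0 i)),
  (fun i => oapp t' t (unlift ord0 i)); split=> [i|].
  by case: unliftP => [j|] _ /=.
rewrite big_ord_recl unlift_none /=; congr (_ + _).
by apply: eq_bigr => i _; rewrite liftK.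
Qed.

Lemma in_span_sum (R : realType) (n : nat) (P : {mpoly R[n]} -> Prop)
    (I : Type) (r : seq I) (Q : pred I) (c : I -> R) (t : I -> {mpoly R[n]}) :
  (forall i, Q i -> P (t i)) -> in_span P (\sum_(i <- r | Q i) c i *: t i).
Proof.
move=> Pt; elim: r => [|i r IHr].
  rewrite big_nil; exists 0%N, (fun=> 0), (fun=> 0).
  by rewrite big_ord0; split=> // -[].
by rewrite big_cons; case: ifP => // Qi; apply: in_span_lin => //; apply: Pt.
Qed.

Lemma in_span_gen (R : realType) (n : nat) (P : {mpoly R[n]} -> Prop) t :
  P t -> in_span P t.
Proof.
move=> Pt; have := @in_span_sum R n P unit [:: tt] predT (fun=> 1) (fun=> t).
by rewrite big_seq1 scale1r; apply.
Qed.

Lemma linear_on_sum (R : realType) (n : nat) (P : {mpoly R[n]} -> Prop) y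
    (I : Type) (r : seq I) (Q : pred I) (c : I -> R) (t : I -> {mpoly R[n]}) :
  linear_on (in_span P) y -> (forall i, Q i -> P (t i)) ->
  y (\sum_(i <- r | Q i) c i *: t i) = \sum_(i <- r | Q i) c i * y (t i).
Proof.
move=> liny Pt.
have span0 : in_span P 0.
  by have := @in_span_sum _ _ P I [::] Q c t Pt; rewrite big_nil.
elim: r => [|i r IHr].
  rewrite !big_nil; have := liny 1 0 0 span0 span0.
  rewrite scaler0 addr0 mul1r => /(congr1 (fun x => x - y 0)).
  by rewrite addrK subrr => ->.
rewrite !big_cons; case: ifP => // Qi; rewrite liny ?IHr //.
  by apply: in_span_gen; exact: Pt.
exact: in_span_sum.
Qed.

(** * Squarefree monomials as sets of variables *)

Definition set_mnm n (J : {set 'I_n}) : 'X_{1..n} :=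
  [multinom (i \in J : nat) | i < n].

Lemma mdeg_set_mnm n (J : {set 'I_n}) : mdeg (set_mnm J) = #|J|.
Proof.
rewrite mdegE -sum1_card [RHS]big_mkcond /=; apply: eq_bigr => i _.
by rewrite mnmE; case: (i \in J).
Qed.

Lemma set_mnm1 n (i : 'I_n) : set_mnm [set i] = U_(i)%MM.
Proof. by apply/mnmP => j; rewrite mnm1E mnmE inE eq_sym. Qed.

Lemma set_mnm0 n : set_mnm set0 = 0%MM :> 'X_{1..n}.
Proof. by apply/mnmP => j; rewrite mnm0E mnmE inE. Qed.

Lemma multilin_mon_set_mnmD n (J K : {set 'I_n}) :
  multilin_mon (set_mnm J + set_mnm K) = set_mnm (J :|: K).
Proof.
by apply/mnmP => i; rewrite !mnmE in_setU; case: (i \in J); case: (i \in K).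
Qed.

Lemma multilin_mon_setUA n (i : 'I_n) (J K : {set 'I_n}) :
  multilin_mon (set_mnm [set i] + set_mnm J + set_mnm K)
    = set_mnm (i |: (J :|: K)).
Proof.
apply/mnmP => j; rewrite !mnmE !inE.
by case: (j == i); case: (j \in J); case: (j \in K).
Qed.

Lemma sos_S_set (R : realType) n d (J : {set 'I_n}) :
  (#|J| <= d)%N -> sos_S d ('X_[R, set_mnm J]).
Proof.
move=> Jd; exists (set_mnm J); split; rewrite ?mdeg_set_mnm // => i.
by rewrite mnmE; case: (i \in J).
Qed.

Lemma sos_T_setU (R : realType) n d (J K : {set 'I_n}) :
  (#|J| <= d)%N -> (#|K| <= d)%N -> sos_T d ('X_[R, set_mnm (J :|: K)]).
Proof.
move=> Jd Kd; exists ord0, 'X_[set_mnm J], 'X_[set_mnm K].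
split; try exact: sos_S_set.
rewrite /hvar unlift_none mul1r -mpolyXD /multilin msuppX big_seq1 mcoeffX eqxx.
by rewrite scale1r multilin_mon_set_mnmD.
Qed.

Lemma sos_T_setU1 (R : realType) n d (i : 'I_n) (J K : {set 'I_n}) :
  (#|J| <= d)%N -> (#|K| <= d)%N -> sos_T d ('X_[R, set_mnm (i |: (J :|: K))]).
Proof.
move=> Jd Kd; exists (lift ord0 i), 'X_[set_mnm J], 'X_[set_mnm K].
split; try exact: sos_S_set.
rewrite /hvar liftK -set_mnm1 -!mpolyXD /multilin msuppX big_seq1 mcoeffX eqxx.
by rewrite scale1r multilin_mon_setUA.
Qed.

(** * What feasibility says about the set moments *)

Definition set_moment (R : realType) n (y : {mpoly R[n]} -> R)
    (J : {set 'I_n}) : R :=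
  y 'X_[set_mnm J].

Lemma set_moment_psd (R : realType) n d (G : Type) (g : G -> {mpoly R[n]}) y :
  sos_feasible d g y -> forall c : {set 'I_n} -> R,
  0 <= \sum_(J : {set 'I_n} | (#|J| <= d)%N)
       \sum_(K : {set 'I_n} | (#|K| <= d)%N)
         c J * c K * set_moment y (J :|: K).
Proof.
move=> [liny _ psd _] c /=.
pose q : {mpoly R[n]} :=
  \sum_(J : {set 'I_n} | (#|J| <= d)%N) c J *: 'X_[set_mnm J].
suff <- : y (multilin (q ^+ 2)) =
    \sum_(J : {set 'I_n} | (#|J| <= d)%N) \sum_(K : {set 'I_n} | (#|K| <= d)%N)
      c J * c K * set_moment y (J :|: K).
  by apply: psd; apply: in_span_sum => K Kd; exact: sos_S_set.
rewrite pair_big_dep expr2 big_distrl /=.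
under [X in multilin X]eq_bigr do rewrite big_distrr /=.
rewrite pair_big_dep /=.
under [X in multilin X]eq_bigr do
  rewrite -scalerAl -scalerAr scalerA -mpolyXD.
rewrite multilin_sumX (linear_on_sum _ _ liny); last first.
  move=> [K L] /= /andP[Kd Ld]; rewrite multilin_mon_set_mnmD.
  exact: sos_T_setU.
by apply: eq_bigr => -[J K] _; rewrite multilin_mon_set_mnmD.
Qed.

(** The localizing inequality of row [j] at the monomial of [I]. *)
Lemma set_moment_row (R : realType) m n (A : 'M[R]_(m, n)) (b : 'cV[R]_m) d y :
  sos_feasible d (packing_constraint A b) y ->
  forall (I : {set 'I_n}) (j : 'I_m), (#|I| <= d)%N ->
  0 <= b j 0 * set_moment y I - \sum_i A j i * set_moment y (i |: I).
Proof.
move=> [liny _ _ loc] I j Id.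
have := loc 'X_[set_mnm I] (inl j).
(* [ord0] indexes the constant term of the row, [lift ord0 i] its ['X_i]. *)
pose coef k := oapp (fun i => - A j i) (b j 0) (unlift ord0 k).
pose var k := oapp (fun i => set_mnm [set i]) 0%MM (unlift (@ord0 n) k).
have -> : 'X_[R, set_mnm I] ^+ 2 * packing_constraint A b (inl j) =
    \sum_(k < n.+1) coef k *: 'X_[var k + set_mnm I + set_mnm I].
  rewrite big_ord_recl /coef /var unlift_none /= add0m mulrBr; congr (_ + _).
    by rewrite mulrC mul_mpolyC expr2 -mpolyXD.
  rewrite mulr_sumr -sumrN; apply: eq_bigr => i _.
  rewrite liftK /= -scalerAr scaleNr; congr (- (_ *: _)).
  by rewrite -addmA mpolyXD mpolyXD set_mnm1 mulrC expr2.
rewrite multilin_sumX (linear_on_sum _ _ liny); last first.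
  move=> k _; rewrite /var; case: (unlift _ k) => [i|] /=.
    by rewrite multilin_mon_setUA; exact: sos_T_setU1.
  by rewrite add0m multilin_mon_set_mnmD; exact: sos_T_setU.
rewrite big_ord_recl /coef /var unlift_none /= add0m.
rewrite multilin_mon_set_mnmD setUid.
under eq_bigr do rewrite liftK /= multilin_mon_setUA setUid mulNr.
rewrite sumrN; apply.
by apply: in_span_gen; exact: sos_S_set.
Qed.

Lemma set_moment_var (R : realType) m n (A : 'M[R]_(m, n)) (b : 'cV[R]_m) d y :
  sos_feasible d (packing_constraint A b) y ->
  forall (I : {set 'I_n}) (i : 'I_n), (#|I| <= d)%N ->
  0 <= set_moment y (i |: I).
Proof.
move=> [_ _ _ loc] I i Id.
have := loc 'X_[set_mnm I] (inr i).
rewrite /= mulrC expr2 -set_mnm1 -!mpolyXD addmA /multilin msuppX big_seq1.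
rewrite mcoeffX eqxx scale1r multilin_mon_setUA setUid; apply.
by apply: in_span_gen; exact: sos_S_set.
Qed.
(** * Packing inequalities *)

(** In the inequality [b j 0 * z J - \sum_i A j i * z (i |: J) >= 0] the terms
    with [i] in [J] all involve [z J], and the others are nonnegative; so
    [z J] has a negative coefficient, and [z J <= 0]. *)
Lemma infeasible_set_moment_eq0 (R : realType) m n (A : 'M[R]_(m, n))
    (b : 'cV[R]_m) d y :
  (forall j i, 0 <= A j i) -> sos_feasible d (packing_constraint A b) y ->
  forall (J : {set 'I_n}) (j : 'I_m), (#|J| <= d)%N ->
  b j 0 < \sum_(i in J) A j i -> set_moment y J = 0.
Proof.
move=> A_ge0 feas J j Jd lt_b.
have zJ_ge0 : 0 <= set_moment y J.
  have [->|[i iJ]] := set_0Vmem J.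
    rewrite /set_moment set_mnm0 mpolyX0.
    by case: feas => _ -> _ _; exact: ler01.
  have <- : i |: J = J by apply/setUidPr; rewrite sub1set.
  exact: set_moment_var feas _ _ Jd.
apply/eqP; rewrite eq_le zJ_ge0 andbT leNgt; apply/negP => zJ_gt0.
have := set_moment_row feas j Jd; rewrite subr_ge0 leNgt => /negP; apply.
rewrite (bigID (fun i => i \in J)) /=.
rewrite (eq_bigr (fun i => A j i * set_moment y J)); last first.
  by move=> i iJ; congr (_ * set_moment y _); apply/setUidPr; rewrite sub1set.
rewrite -mulr_suml ltr_wpDr ?ltr_pM2r //.
apply: sumr_ge0 => i _; apply: mulr_ge0 => //.
exact: set_moment_var feas _ _ Jd.
Qed.

Lemma valid_on_feasible_sets (R : realType) m n (A : 'M[R]_(m, n))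
    (b : 'cV[R]_m) (a0 : R) (a : 'cV[R]_n) :
  (forall x : 'cV[R]_n,
    packing_feasible A b x -> 0 <= a0 - (a^T *m x) 0 0) ->
  forall J : {set 'I_n}, (forall j, \sum_(i in J) A j i <= b j 0) ->
  \sum_(i in J) a i 0 <= a0.
Proof.
move=> valid J feasJ.
pose x : 'cV[R]_n := \col_i (i \in J)%:R.
have mulx k (B : 'M[R]_(k, n)) l : (B *m x) l 0 = \sum_(i in J) B l i.
  rewrite mxE [RHS]big_mkcond; apply: eq_bigr => i _.
  by rewrite mxE mulr_natr mulrb.
have /valid : packing_feasible A b x.
  split=> [i|j]; last by rewrite mulx.
  by rewrite mxE; case: (i \in J); rewrite ?expr1n ?expr0n subrr.
by rewrite mulx subr_ge0; under eq_bigr do rewrite mxE.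
Qed.

Theorem lemma6p1 (R : realType) (m n : nat)
    (A : 'M[R]_(m, n)) (b : 'cV[R]_m)
    (A_ge0 : forall j i, 0 <= A j i) (b_ge0 : forall j, 0 <= b j 0)
    (pi : nat) (pi_gt0 : (0 < pi)%N)
    (a0 : R) (a : 'cV[R]_n)
    (a0_ge0 : 0 <= a0) (a_ge0 : forall i, 0 <= a i 0)
    (valid : forall x : 'cV[R]_n,
      packing_feasible A b x -> 0 <= a0 - (a^T *m x) 0 0)
    (pitch_le : (packing_pitch a0 a <= pi)%N)
    (y : {mpoly R[n]} -> R)
    (y_feas : sos_feasible pi.+1 (packing_constraint A b) y) :
  0 <= a0 - \sum_(i < n) a i 0 * y 'X_i.
Proof.
pose z := set_moment y.
pose feas (J : {set 'I_n}) := [forall j, \sum_(i in J) A j i <= b j 0].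
pose S := [set i | 0 < a i 0].
pose good (J : {set 'I_n}) := (J \subset S) && feas J.
have psd := set_moment_psd y_feas.
have good_sum J : good J -> \sum_(i in J) a i 0 <= a0.
  by move=> /andP[_ /forallP]; exact: valid_on_feasible_sets.
have good_card J : good J -> (#|J| <= pi)%N.
  move=> gJ; apply: leq_trans pitch_le.
  apply: card_le_packing_pitch (good_sum _ gJ) => i iJ.
  by move: gJ => /andP[/subsetP/(_ i iJ)]; rewrite inE.
have z_bad_small (J : {set 'I_n}) : (#|J| <= pi.+1)%N -> ~~ feas J -> z J = 0.
  move=> Jd /forallPn[j]; rewrite -ltNge.
  exact: infeasible_set_moment_eq0 y_feas _ _ Jd.
have z_bad J K : good J -> good K -> ~~ good (J :|: K) -> z (J :|: K) = 0.
  move=> gJ gK; set L := J :|: K => badL.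
  have LS : L \subset S.
    by rewrite subUset; case/andP: gJ => -> _; case/andP: gK => -> _.
  have [Ld|Ld] := leqP #|L| pi.+1.
    by apply: z_bad_small => //; move: badL; rewrite /good LS.
  have [s [s_uniq size_s sL]] := card_geqP (ltnW Ld).
  pose I := [set i in s].
  have cardI : #|I| = pi.+1 by rewrite cardsE (card_uniqP s_uniq).
  have IL : I \subset L by apply/subsetP => i; rewrite inE; exact: sL.
  have -> : L = I :|: (L :\: I) by rewrite -[LHS](setID L I) (setIidPr IL).
  apply: (psd_moment_eq0 psd); first by rewrite cardI.
    rewrite cardsDS // cardI.
    have : (#|L| <= #|J| + #|K|)%N := leq_card_setU J K.
    have := good_card _ gJ; have := good_card _ gK; lia.
  apply: z_bad_small; first by rewrite cardI.
  apply/negP => feasI; have /good_card : good I.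
    by rewrite /good feasI andbT; exact: subset_trans LS.
  by rewrite cardI ltnn.
have [||mu [mu_ge0 mu_bad z_mu]] := positive_moments_measure psd _ _ z_bad.
- by move=> J /good_card /leqW.
- move=> J K KJ /andP[JS /forallP feasJ]; rewrite /good (subset_trans KJ) //=.
  apply/forallP => j; apply: le_trans (feasJ j).
  rewrite [leRHS](big_setID K) /= (setIidPr KJ) lerDl.
  exact: sumr_ge0.
(* When [set i] is not good, either [i] is outside [S] and its coefficient is
   [0], or it is infeasible and its moment is [0]. *)
have -> : \sum_(i < n) a i 0 * y 'X_i =
    \sum_i a i 0 * \sum_(I : {set 'I_n} | [set i] \subset I) mu I.
  apply: eq_bigr => i _; rewrite -z_mu -set_mnm1 -/(set_moment y [set i]) -/z.
  have [iS|iS] := boolP (i \in S); last first.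
    have -> : a i 0 = 0.
      by apply/eqP; move: iS; rewrite inE lt_neqAle a_ge0 andbT negbK eq_sym.
    by rewrite !mul0r.
  case: ifP => // /negbT; rewrite /good sub1set iS /= => bad_i.
  by rewrite z_bad_small ?cards1.
have -> : a0 = \sum_I mu I * a0.
  rewrite -mulr_suml.
  have <- : 1 = \sum_I mu I; last by rewrite mul1r.
  have := z_mu set0; under eq_bigl do rewrite sub0set.
  move=> <-; rewrite /good sub0set /= ifT; last first.
    by apply/forallP => j; rewrite big_set0.
  by rewrite /z /set_moment set_mnm0 mpolyX0; case: y_feas.
have -> : \sum_i a i 0 * \sum_(I : {set 'I_n} | [set i] \subset I) mu I =
    \sum_(I : {set 'I_n}) mu I * \sum_(i in I) a i 0.
  under eq_bigr do rewrite mulr_sumr.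
  rewrite (exchange_big_dep predT) //=; apply: eq_bigr => I _.
  by rewrite mulr_sumr; apply: eq_big => [i|i _]; rewrite ?sub1set // mulrC.
rewrite -sumrB; apply: sumr_ge0 => I _; rewrite -mulrBr.
have [gI|/mu_bad ->] := boolP (good I); last by rewrite mul0r.
by rewrite mulr_ge0 // subr_ge0 good_sum.
Qed.
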